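(* Let $\gamma$ be an odd-symmetric half-area $2n$-polygon. Then $\gamma$ has exactly $n$ cusps, i.e. $\mathcal{M}(i)$ is a cusp of $\mathcal{M}$ for exactly $n$ indices $i\in\{1,\dots,n\}$ (that is, for all of them).
   Context: Indices are taken modulo $2n$. A half-area $2n$-polygon is a convex polygon with $2n$ vertices $\gamma(1),\dots,\gamma(2n)\in\mathbb{R}^2$, listed in cyclic order along its boundary (collinear consecutive vertices are allowed), such that, for every $i$, the line $l(i)$ through the opposite vertices $\gamma(i)$ and $\gamma(i+n)$ divides the polygonal region into two parts of equal area. Let $\lambda(i+\tfrac12)=\dfrac{|\gamma(i+n)-\gamma(i+1)|}{|\gamma(i+n+1)-\gamma(i)|}$ be the ratio of the lengths of the central diagonals $\gamma(i+1)\gamma(i+n)$ and $\gamma(i)\gamma(i+n+1)$. A half-area polygon is odd-symmetric if, for some constant $c$, $\lambda(i+\tfrac12)=c$ for $i$ odd and $\lambda(i+\tfrac12)=\tfrac1c$ for $i$ even (the value $c=1$ is allowed by this definition). The mid-points envelope $\mathcal{M}$ is the polygon with vertices $\mathcal{M}(i)=\tfrac12(\gamma(i)+\gamma(i+n))$ (so $\mathcal{M}(i+n)=\mathcal{M}(i)$). $\mathcal{M}(i)$ is a cusp of $\mathcal{M}$ if the line $l(i)$ separates the segments $\mathcal{M}(i-1)\mathcal{M}(i)$ and $\mathcal{M}(i)\mathcal{M}(i+1)$. *)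

(* Defs.v *)
From HB Require Import structures.
From mathcomp Require Import all_boot all_order all_algebra.
From mathcomp Require Import all_classical all_reals all_analysis.

Set Implicit Arguments.
Unset Strict Implicit.
Unset Printing Implicit Defensive.

Import Order.TTheory GRing.Theory Num.Theory.
Import numFieldNormedType.Exports.

Local Open Scope classical_set_scope.
Local Open Scope ring_scope.

(* The plane is R * R. The library norm on a product is the maximum norm, so
   the Euclidean length is defined here. *)
Definition dist2 (R : realType) (p q : R * R) : R :=
  Num.sqrt ((q.1 - p.1) ^+ 2 + (q.2 - p.2) ^+ 2).

Definition area (R : realType) (A : set (R * R)) : \bar R :=
  ((@lebesgue_measure R) \x (@lebesgue_measure R))%E A.

(* cross a b p = det (b - a, p - a): positive on the left of the line from a
   to b, zero on that line. *)
Definition cross (R : realType) (a b p : R * R) : R :=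
  (b.1 - a.1) * (p.2 - a.2) - (b.2 - a.2) * (p.1 - a.1).

Definition left_side (R : realType) (a b : R * R) : set (R * R) :=
  [set p | 0 <= cross a b p].

Definition right_side (R : realType) (a b : R * R) : set (R * R) :=
  [set p | cross a b p <= 0].

Definition segment (R : realType) (p q : R * R) : set (R * R) :=
  [set x | exists t : R, [/\ 0 <= t, t <= 1 & x = (1 - t) *: p + t *: q]].

(* The sides are closed half-planes: a set that touches or lies on the line
   through a and b counts as being on either side. *)
Definition line_separates (R : realType) (a b : R * R) (A B : set (R * R)) :
    Prop :=
  (A `<=` left_side a b /\ B `<=` right_side a b) \/
  (A `<=` right_side a b /\ B `<=` left_side a b).

(* Indices live in 'Z_m, so i + 1 is the cyclic successor. Each side of the
   polygon has all vertices on its left (or, when the boundary is traversed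
   clockwise, each has them on its right); injectivity then prevents the
   polygon from going round more than once. Equality is allowed in the side
   conditions, hence collinear consecutive vertices are too. *)
Definition convex_polygon (R : realType) (m : nat) (g : 'Z_m -> R * R) : Prop :=
  [/\ injective g,
      exists i j k, cross (g i) (g j) (g k) != 0 &
      (forall i j, left_side (g i) (g (i + 1)) (g j)) \/
      (forall i j, right_side (g i) (g (i + 1)) (g j))].

(* The convex hull of the vertices. *)
Definition polygon_region (R : realType) (m : nat) (g : 'Z_m -> R * R) :
    set (R * R) :=
  [set p | exists w : 'Z_m -> R,
    [/\ forall i, 0 <= w i, \sum_i w i = 1 & p = \sum_i w i *: g i]].

Definition half_area_polygon (R : realType) (n : nat)
    (g : 'Z_(2 * n) -> R * R) : Prop :=
  convex_polygon g /\
  forall i, area (polygon_region g `&` left_side (g i) (g (i + n%:R))) =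
            area (polygon_region g `&` right_side (g i) (g (i + n%:R))).

(* lambda g i is the ratio attached to the half-integer i + 1/2. *)
Definition lambda (R : realType) (n : nat) (g : 'Z_(2 * n) -> R * R)
    (i : 'Z_(2 * n)) : R :=
  dist2 (g (i + 1)) (g (i + n%:R)) / dist2 (g i) (g (i + n%:R + 1)).

(* Parity of i is that of its representative in [0, 2n), which is the parity
   of every integer in the residue class. *)
Definition odd_symmetric (R : realType) (n : nat) (g : 'Z_(2 * n) -> R * R) :
    Prop :=
  exists c : R, forall i, lambda g i = if odd i then c else c^-1.

Definition midpoint_envelope (R : realType) (n : nat)
    (g : 'Z_(2 * n) -> R * R) (i : 'Z_(2 * n)) : R * R :=
  2^-1 *: (g i + g (i + n%:R)).

Definition is_cusp (R : realType) (n : nat) (g : 'Z_(2 * n) -> R * R)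
    (i : 'Z_(2 * n)) : Prop :=
  line_separates (g i) (g (i + n%:R))
    (segment (midpoint_envelope g (i - 1)) (midpoint_envelope g i))
    (segment (midpoint_envelope g i) (midpoint_envelope g (i + 1))).

(* Main.v *)
Require Import Defs.
From mathcomp Require Import all_boot all_order all_algebra.
From mathcomp Require Import all_classical all_reals all_analysis.
From mathcomp Require Import measurable_realfun ring lra.
Import Order.TTheory GRing.Theory Num.Theory.
Import numFieldNormedType.Exports.
Local Open Scope ring_scope.

(** Write a, p, b, q for the vertices with indices i, i+1, i+n, i+n+1. The two
    consecutive halving diagonals ab and pq cut the polygonal region into four
    pieces. Since each diagonal halves the area, the two opposite pieces
    adjacent to the sides ap and bq have equal area. Each of these pieces is a
    triangle, bounded by a side of the polygon and the two diagonals, and hence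
    (comparing the areas of apb and pbq, which arise by adding the triangle cut
    off by pb) a and q are equally far from the line pb: the central diagonals
    pb and aq are parallel. This is [central_diagonals_parallel].

    Parallelism turns the ratio lambda of their lengths into a ratio of
    distances to the line ab: the distance of p is lambda times the distance of
    q, on the other side of ab. So the midpoint of pq, which is the next vertex
    of the envelope, has signed distance to ab proportional to 1 - lambda(i),
    with a factor whose sign depends only on the orientation of the polygon. By
    the symmetry of the configuration under exchanging the two diagonals, the
    previous vertex of the envelope has a signed distance proportional to
    1 - lambda(i-1), with a factor of the same sign. Odd symmetry makes
    lambda(i-1) and lambda(i) inverse to each other, so that 1 - lambda(i-1)
    and 1 - lambda(i) have opposite signs and the line separates the two sides
    of the envelope at every index.

    The cyclic order of the vertices enters only through the supporting lines of
    the sides ap and bq: they bound the two triangles, and they determine on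
    which side of each diagonal the four points lie, because [cross] is
    invariant under cyclic permutation of its arguments.

    The areas are areas of Lebesgue measurable sets. The equality of the areas
    of the two triangles is expressed in the coordinates given by the signed
    distances to the two diagonals, in which both triangles become right
    triangles with legs on the axes; [area_affine], the behaviour of area under
    affine maps, expresses their areas as multiples of the area of one standard
    triangle, which is positive and finite and can be cancelled. *)

Local Notation mu := lebesgue_measure.
Local Notation plane R := (measurableTypeR R * measurableTypeR R)%type.

(** * Area and affine maps *)

Section Area.
Local Open Scope classical_set_scope.
Context {R : realType}.
Implicit Types A B : set (plane R).

Lemma area_ge0 A : (0 <= area A)%E.
Proof. exact: (measure_ge0 (mu \x mu)%E). Qed.

Lemma area_le A B : measurable A -> measurable B -> A `<=` B ->
  (area A <= area B)%E.
Proof.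
by move=> mA mB AB; apply: (le_measure (mu \x mu)%E) => //; rewrite inE.
Qed.

Lemma area_ysection A : measurable A -> area A = (mu \x^ mu)%E A.
Proof.
move=> mA.
apply: (@product_measure_unique _ _ _ _ _ mu mu (mu \x^ mu)%E) => //.
by move=> B C mB mC; exact: product_measure2E.
Qed.

(** By uniqueness of Lebesgue measure, it suffices to compare both sides on
    half-open intervals. *)
Lemma lebesgue_measure_affine (k c : R) (B : set (measurableTypeR R)) :
  k != 0 -> measurable B ->
  (`|k|%:E * mu ((fun y : R => k * y + c)%R @^-1` B) = mu B)%E.
Proof.
move=> k0 mB; pose f (y : measurableTypeR R) : measurableTypeR R := k * y + c.
have mf : measurable_fun [set: measurableTypeR R] f.
  by apply: measurable_funD => //; exact: mulrl_measurable.
unshelve epose (pf :=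
  (pushforward mu f : {measure set (measurableTypeR R) -> \bar R})).
  exact: mf.
apply/esym; apply: (@lebesgue_measure_unique R (mscale `|k|%:nng pf)) => //.
move=> _ [[a b]] _ <-.
change (mu `]a, b]%classic = `|k|%:E * mu (f @^-1` `]a, b]%classic))%E.
rewrite lebesgue_measure_itv/= lte_fin.
have [k1|k1|k1] := ltgtP k 0; last by rewrite k1 eqxx in k0.
  rewrite [X in mu X](_ : _ = `[(b - c) / k, (a - c) / k[%classic); last first.
    by apply/seteqP; split=> x /=;
      rewrite !in_itv /f/= ler_ndivrMr// ltr_ndivlMr//;
      move=> /andP[? ?]; apply/andP; split; lra.
  rewrite lebesgue_measure_itv/= lte_fin ltr_nM2r ?invr_lt0// ltrD2r.
  case: ifPn => ab; last by rewrite mule0.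
  by rewrite -!EFinB -EFinM ltr0_norm//; congr EFin; field.
rewrite [X in mu X](_ : _ = `](a - c) / k, (b - c) / k]%classic); last first.
  by apply/seteqP; split=> x /=;
    rewrite !in_itv /f/= ler_pdivlMr// ltr_pdivrMr//;
    move=> /andP[? ?]; apply/andP; split; lra.
rewrite lebesgue_measure_itv/= lte_fin ltr_pM2r ?invr_gt0// ltrD2r.
case: ifPn => ab; last by rewrite mule0.
by rewrite -!EFinB -EFinM gtr0_norm//; congr EFin; field.
Qed.

Definition affine_map (p q c r s d : R) (z : R * R) : R * R :=
  (p * z.1 + q * z.2 + c, r * z.1 + s * z.2 + d).

Lemma measurable_affine_preimage (p q c r s d : R) A : measurable A ->
  measurable (affine_map p q c r s d @^-1` A : set (plane R)).
Proof.
have m1 : measurable_fun [set: plane R] (fun z => z.1 : measurableTypeR R).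
  exact: measurable_fst.
have m2 : measurable_fun [set: plane R] (fun z => z.2 : measurableTypeR R).
  exact: measurable_snd.
have h u v w : measurable_fun [set: plane R]
    (fun z => u * z.1 + v * z.2 + w : measurableTypeR R).
  apply: measurable_funD => //.
  by apply: measurable_funD; exact: measurable_funM.
have maff : measurable_fun [set: plane R]
    (affine_map p q c r s d : plane R -> plane R).
  by apply/measurable_fun_pairP; split; exact: h.
by move=> mA; rewrite -[X in measurable X]setTI; exact: maff.
Qed.

(** The map acts on each vertical line by an affine map with the same slope s,
    so this is [lebesgue_measure_affine] integrated over the vertical
    sections. *)
Lemma area_vshear (r s d : R) A : s != 0 -> measurable A ->
  (`|s|%:E * area (affine_map 1 0 0 r s d @^-1` A) = area A)%E.
Proof.
move=> s0 mA; rewrite /area /product_measure1 -ge0_integralZl//; last first.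
  by apply: measurable_fun_xsection; exact: measurable_affine_preimage.
apply: eq_integral => x _ /=.
have mAx : measurable (xsection A x) by exact: measurable_xsection.
rewrite -(lebesgue_measure_affine s (r * x + d) _ s0 mAx).
congr (_ * mu _)%E; rewrite !xsectionE /affine_map; apply/seteqP.
by split=> y /=; rewrite mul1r mul0r !addr0 [s * y + _]addrCA addrA.
Qed.

Lemma area_hshear (p q c : R) A : p != 0 -> measurable A ->
  (`|p|%:E * area (affine_map p q c 0 1 0 @^-1` A) = area A)%E.
Proof.
move=> p0 mA; rewrite !area_ysection//; last exact: measurable_affine_preimage.
rewrite /product_measure2 -ge0_integralZl//; last first.
  by apply: measurable_fun_ysection; exact: measurable_affine_preimage.
apply: eq_integral => y _ /=.
have mAy : measurable (ysection A y) by exact: measurable_ysection.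
rewrite -(lebesgue_measure_affine p (q * y + c) _ p0 mAy).
congr (_ * mu _)%E; rewrite !ysectionE /affine_map; apply/seteqP.
by split=> x /=; rewrite mul1r mul0r add0r !addr0 addrA.
Qed.

(** A linear map whose upper left entry p is nonzero factors as a vertical
    shear after a horizontal one, each of them combined with a scaling. *)
Lemma area_affine (p q c r s d : R) A : p * s - q * r != 0 -> measurable A ->
  (`|p * s - q * r|%:E * area (affine_map p q c r s d @^-1` A) = area A)%E.
Proof.
move=> D0 mA.
wlog p0 : p q c r s d A D0 mA / p != 0.
  move=> H; have [p0|p0] := eqVneq p 0; last exact: H.
  (* Splitting off the shear (x, y) |-> (x, x + y) turns the entry p = 0 into
     - q, and q cannot vanish as well. *)
  have q0 : q != 0 by apply: contraNneq D0 => ->; rewrite p0 !mul0r subrr.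
  pose B := affine_map (- q) q c (r - s) s d @^-1` A.
  have mB : measurable (B : set (plane R)).
    exact: measurable_affine_preimage.
  rewrite -(H (- q) q c (r - s) s d A) ?oppr_eq0//; last first.
    by rewrite (_ : - q * s - q * (r - s) = p * s - q * r)// p0; ring.
  rewrite -/B -[in RHS](area_vshear 1 1 0) ?oner_neq0// normr1 mul1e.
  congr (_%:E * area _)%E; first by rewrite p0; congr `|_|; ring.
  rewrite /B -comp_preimage; congr (_ @^-1` A); apply/funext => z /=.
  by rewrite /affine_map p0; congr pair => /=; ring.
pose r' := r / p; pose s' := s - r' * q; pose d' := d - r' * c.
have De : p * s - q * r = s' * p by rewrite /s' /r'; field.
have s0 : s' != 0 by move: D0; rewrite De mulf_eq0 negb_or => /andP[].
rewrite -(area_vshear r' s' d' A s0 mA)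
  -[in RHS](area_hshear p q c)//; last first.
  exact: measurable_affine_preimage.
rewrite De normrM EFinM -muleA; congr (_ * (_ * area _))%E.
rewrite -comp_preimage; congr (_ @^-1` A); apply/funext => z /=.
by rewrite /affine_map /d' /s' /r'; congr pair => /=; field.
Qed.

End Area.

(** * Half-planes and lines *)

Section HalfPlanes.
Local Open Scope classical_set_scope.
Context {R : realType}.
Implicit Types a b : R * R.

Lemma measurable_half_plane (u v w : R) :
  measurable ([set z | 0 <= u * z.1 + v * z.2 + w] : set (plane R)).
Proof.
rewrite (_ : [set z | _] =
    affine_map u v w 0 0 0 @^-1` (`[0, +oo[ `*` setT)).
  by apply: measurable_affine_preimage; exact: measurableX.
by apply/seteqP; split=> z /=; rewrite in_itv/= andbT => // -[].
Qed.

Lemma crossE a b (z : R * R) : cross a b z =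
  (a.2 - b.2) * z.1 + (b.1 - a.1) * z.2 + (a.1 * b.2 - a.2 * b.1).
Proof. by rewrite /cross; ring. Qed.

Lemma crossNC a b (z : R * R) : cross b a z = - cross a b z.
Proof. by rewrite /cross; ring. Qed.

Lemma right_sideE a b : right_side a b = left_side b a.
Proof.
by apply/seteqP; split=> z;
  rewrite /right_side /left_side /= (crossNC a b) oppr_ge0.
Qed.

Lemma measurable_left_side a b : measurable (left_side a b : set (plane R)).
Proof.
rewrite (_ : left_side a b = [set z | 0 <= (a.2 - b.2) * z.1
  + (b.1 - a.1) * z.2 + (a.1 * b.2 - a.2 * b.1)]).
  exact: measurable_half_plane.
by apply/seteqP; split=> z; rewrite /left_side /= crossE.
Qed.

(** In coordinates one of which is [cross a b], the line through a and b is an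
    axis, which is a product with a null factor. *)
Lemma area_line a b (A : set (plane R)) : measurable A -> a != b ->
  A `<=` [set z | cross a b z = 0] -> area A = 0%E.
Proof.
move=> mA ab Al; pose u := a.2 - b.2; pose v := b.1 - a.1.
pose w := a.1 * b.2 - a.2 * b.1.
have D0 : u * u - v * - v != 0.
  apply: contra ab => /eqP; have := sqr_ge0 u; have := sqr_ge0 v => v0 u0 h.
  have : u ^+ 2 = 0 by lra.
  have : v ^+ 2 = 0 by lra.
  move=> /eqP; rewrite sqrf_eq0 subr_eq0 => /eqP e1.
  move=> /eqP; rewrite sqrf_eq0 subr_eq0 => /eqP e2.
  by rewrite [a]surjective_pairing [b]surjective_pairing e1 e2.
have m01 : measurable ([set 0] `*` setT : set (plane R)).
  exact: measurableX.
have := area_affine u v w (- v) u 0 _ D0 m01.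
rewrite [RHS](_ : _ = 0%E); last first.
  rewrite /area product_measure1E//= [X in (X * _)%E](_ : _ = 0%E) ?mul0e//.
  exact: lebesgue_measure_set1.
move=> /eqP; rewrite mule_eq0 eqe normr_eq0 (negbTE D0)/= => /eqP G0.
apply/eqP; rewrite eq_le area_ge0 andbT -G0.
apply: area_le => //; first exact: measurable_affine_preimage.
by move=> z /Al /=; rewrite crossE => ->.
Qed.

Lemma area_split a b (A : set (plane R)) : measurable A -> a != b ->
  (area A = area (A `&` left_side a b) + area (A `&` right_side a b))%E.
Proof.
move=> mA ab; have mL := measurable_left_side a b.
have mN := measurable_left_side b a.
rewrite right_sideE.
have splt (B : set (plane R)) : measurable B ->
    (area B = area (B `&` left_side a b) + area (B `\` left_side a b))%E.
  by move=> mB; rewrite addeC; exact: (measureDI (mu \x mu)%E).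
rewrite [LHS]splt// [X in _ = (_ + X)%E]splt//; last exact: measurableI.
(* The two closed half-planes overlap in the line, which is null. *)
rewrite [X in _ = (_ + (X + _))%E](@area_line a b)//; last 2 first.
  by apply: measurableI => //; exact: measurableI.
  move=> z [[_]]; rewrite -right_sideE /right_side /left_side/= => ? ?.
  by apply/eqP; rewrite eq_le; apply/andP.
rewrite add0e; congr (_ + area _)%E.
apply/seteqP; split=> z; last by move=> [[]].
move=> [Az Lz]; split=> //; split=> //.
rewrite -right_sideE /right_side /=; move/negP: Lz; rewrite -ltNge; exact: ltW.
Qed.

End HalfPlanes.

(** * The polygonal region *)

Section Region.
Local Open Scope classical_set_scope.
Context {R : realType}.

(** The region is the image of the standard simplex under a continuous map. *)
Lemma polygon_region_compact (m : nat) (g : 'Z_m -> R * R) :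
  compact (polygon_region g).
Proof.
pose S := [set v : 'rV[R]_(Zp_trunc m).+2 |
  forall i, `[0, 1]%classic (v ord0 i)].
pose s (v : 'rV[R]_(Zp_trunc m).+2) : R := \sum_i v ord0 i.
pose f (v : 'rV[R]_(Zp_trunc m).+2) : R * R := \sum_i v ord0 i *: g i.
have cS : compact S.
  apply: (@rV_compact R _ (fun=> `[0, 1]%classic)) => i.
  exact: segment_compact.
have cc i : continuous (fun v : 'rV[R]_(Zp_trunc m).+2 => v ord0 i).
  exact: coord_continuous.
have cs : continuous s.
  by apply: continuous_big => [|i _]; [exact: add_continuous|exact: cc].
have cf : continuous f.
  apply: continuous_big => [|i _ v]; first exact: add_continuous.
  by apply: cvgZr_tmp; [exact: (nbhs_filter v)|exact: cc].
have -> : polygon_region g = f @` (S `&` s @^-1` [set 1]).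
  apply/seteqP; split=> [p [w [w0 w1 ->]]|_ [v [Sv sv] <-]].
    exists (\row_i w i).
      split; last by rewrite /= /s; under eq_bigr do rewrite mxE.
      move=> i /=; rewrite mxE in_itv/= w0/= -w1 (bigD1 i)//= lerDl.
      by apply: sumr_ge0.
    by rewrite /f; under eq_bigr do rewrite mxE.
  exists (fun i => v ord0 i); split => // i.
  by have := Sv i; rewrite /= in_itv/= => /andP[].
apply: continuous_compact.
  by apply: continuous_subspaceT.
apply: compact_closedI => //.
by apply: closed_comp => // x _; exact: cs.
Qed.

(** The measurable sets of the plane are generated by products of measurable
    sets; an open set is the countable union of the rational boxes that it
    contains. *)
Lemma measurable_closed_plane (A : set (R * R)) : closed A ->
  measurable (A : set (plane R)).
Proof.
move=> cA; rewrite -(setCK A); apply: measurableC.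
have oA : open (~` A) by exact: closed_openC.
pose I (q : (rat * rat) * (rat * rat)) : set (plane R) :=
  `]ratr q.1.1, ratr q.1.2[%classic `*` `]ratr q.2.1, ratr q.2.2[%classic.
have -> : ~` A = \bigcup_(q in [set q | I q `<=` ~` A]) I q.
  apply/seteqP; split => [p pA|p [q]]; last exact.
  have [e /= e0 eA] : nbhs_ball p (~` A).
    by rewrite nbhs_ballE; exact: open_nbhs_nbhs.
  have rat_around (x : R) : exists q : rat * rat,
      x - e < ratr q.1 < x /\ x < ratr q.2 < x + e.
    have [q1 h1] : exists q1 : rat, x - e < ratr q1 < x.
      have [|q] := @rat_in_itvoo _ (x - e) x; first by lra.
      by rewrite in_itv/= => ?; exists q.
    have [|q] := @rat_in_itvoo _ x (x + e); first by lra.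
    by rewrite in_itv/= => ?; exists (q1, q).
  have [q1 [/andP[? ?] /andP[? ?]]] := rat_around p.1.
  have [q2 [/andP[? ?] /andP[? ?]]] := rat_around p.2.
  exists (q1, q2); last by split; rewrite /= in_itv/=; apply/andP.
  move=> z [/=]; rewrite !in_itv/= => /andP[? ?] /andP[? ?].
  apply: eA; split; rewrite -ball_normE /= ltr_norml; apply/andP; split; lra.
rewrite bigcup_mkcond; apply: countable_bigcupT_measurable => // q.
by case: ifP => // _; apply: measurableX.
Qed.

Lemma measurable_compact_plane (A : set (R * R)) : compact A ->
  measurable (A : set (plane R)).
Proof.
move=> cA; apply: measurable_closed_plane; apply: compact_closed cA.
exact: norm_hausdorff.
Qed.

Lemma compact_area_lty (A : set (R * R)) : compact A -> (area A < +oo)%E.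
Proof.
move=> cA; have := compact_bounded cA.
move=> [M [_ /(_ (`|M| + 1))]].
have M1 : M < `|M| + 1 by rewrite ltr_pwDr// ler_norm.
move=> /(_ M1) AM.
have mA := measurable_compact_plane _ cA.
set K := `|M| + 1 in M1 AM.
pose B : set (plane R) := `[-K, K]%classic `*` `[-K, K]%classic.
have AB : A `<=` B.
  move=> z /AM /=; rewrite prod_normE ge_max => /andP[z1 z2].
  by split; rewrite /= in_itv/= -ler_norml.
apply: (@le_lt_trans _ _ (area B)).
  by apply: area_le => //; exact: measurableX.
rewrite /area product_measure1E//= !lebesgue_measure_itv/=.
by case: ifP => _; rewrite ?mule0 // -EFinB -EFinM ltry.
Qed.

End Region.

(** Combinations of three points, rather than two, because the region has to be
    shown to contain a triangle. *)
Definition convex3 {R : realType} (P : set (R * R)) : Prop :=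
  forall (x y z : R * R) (s t u : R), P x -> P y -> P z ->
  0 <= s -> 0 <= t -> 0 <= u -> s + t + u = 1 ->
  P (s * x.1 + t * y.1 + u * z.1, s * x.2 + t * y.2 + u * z.2).

Section RegionConvex.
Local Open Scope classical_set_scope.
Context {R : realType} (m : nat) (g : 'Z_m -> R * R).

Lemma comb_fst (w : 'Z_m -> R) : (\sum_i w i *: g i).1 = \sum_i w i * (g i).1.
Proof. exact: (big_morph fst (fun x y => erefl) erefl). Qed.

Lemma comb_snd (w : 'Z_m -> R) : (\sum_i w i *: g i).2 = \sum_i w i * (g i).2.
Proof. exact: (big_morph snd (fun x y => erefl) erefl). Qed.

Lemma polygon_region_vertex i : polygon_region g (g i).
Proof.
exists (fun j => (j == i)%:R); split => [j||]; first exact: ler0n.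
  by rewrite (bigD1 i)//= eqxx big1 ?addr0// => j /negbTE ->.
rewrite (bigD1 i)//= eqxx scale1r big1 ?addr0// => j /negbTE ->; exact: scale0r.
Qed.

Lemma polygon_region_convex3 : convex3 (polygon_region g).
Proof.
move=> x y z s t u [v [v0 v1 ->]] [w [w0 w1 ->]] [r [r0 r1 ->]] s0 t0 u0 stu.
exists (fun i => s * v i + t * w i + u * r i); split.
- by move=> i; rewrite !addr_ge0// mulr_ge0.
- by rewrite !big_split/= -!mulr_sumr v1 w1 r1 !mulr1.
- rewrite [RHS]surjective_pairing !comb_fst !comb_snd !mulr_sumr -!big_split/=.
  by congr pair; apply: eq_bigr => i _; ring.
Qed.

Lemma polygon_region_left a b : (forall j, left_side a b (g j)) ->
  polygon_region g `<=` left_side a b.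
Proof.
move=> H _ [w [w0 w1 ->]]; rewrite /left_side /= crossE comb_fst comb_snd.
rewrite -[X in _ + X]mulr1 -w1 !mulr_sumr -!big_split/=; apply: sumr_ge0 => i _.
have := H i; rewrite /left_side /= crossE => h.
by have := mulr_ge0 (w0 i) h; lra.
Qed.

End RegionConvex.

(** * Right triangles *)

(** The triangle with vertices (0, 0), (h, 0), (0, k), provided that h and k are
    nonnegative and not both zero; for h = k = 0 it is the whole quadrant. *)
Definition right_triangle {R : realType} (h k : R) : set (R * R) :=
  [set z | [/\ 0 <= z.1, 0 <= z.2 & k * z.1 + h * z.2 <= h * k]].

Section RightTriangle.
Local Open Scope classical_set_scope.
Context {R : realType}.
Implicit Types h k : R.

Lemma measurable_right_triangle h k :
  measurable (right_triangle h k : set (plane R)).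
Proof.
rewrite (_ : right_triangle h k = [set z | 0 <= 1 * z.1 + 0 * z.2 + 0]
  `&` [set z | 0 <= 0 * z.1 + 1 * z.2 + 0]
  `&` [set z | 0 <= - k * z.1 + (- h) * z.2 + h * k]).
  by apply: measurableI; [apply: measurableI|]; exact: measurable_half_plane.
by apply/seteqP; split=> z; rewrite /right_triangle /=;
  [move=> [? ? ?]; split; [split|] | move=> [[? ?] ?]; split]; lra.
Qed.

Lemma area_right_triangle1_gt0 : (0 < area (right_triangle (1 : R) 1))%E.
Proof.
pose B : set (plane R) := `[0, 2^-1]%classic `*` `[0, 2^-1]%classic.
apply: (@lt_le_trans _ _ (area B)).
  rewrite /area product_measure1E//= !lebesgue_measure_itv/= lte_fin.
  by rewrite invr_gt0 ltr0n -!EFinB -EFinM lte_fin; lra.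
apply: area_le; [exact: measurableX|exact: measurable_right_triangle|].
by move=> z []/=; rewrite !in_itv/= => /andP[? ?] /andP[? ?]; split; lra.
Qed.

Lemma area_right_triangle1_lty : (area (right_triangle (1 : R) 1) < +oo)%E.
Proof.
pose B : set (plane R) := `[0, 1]%classic `*` `[0, 1]%classic.
apply: (@le_lt_trans _ _ (area B)); last first.
  rewrite /area product_measure1E//= !lebesgue_measure_itv/= lte_fin.
  by rewrite ltr01 -!EFinB -EFinM ltry.
apply: area_le; [exact: measurable_right_triangle|exact: measurableX|].
by move=> z [? ? ?]; split; rewrite /= in_itv/=; apply/andP; split; lra.
Qed.

(** A scaling of the axes carries the triangle to the one with unit legs; if one
    of h and k vanishes, the triangle degenerates to a part of an axis. *)
Lemma area_right_triangle h k : 0 <= h -> 0 <= k -> 0 < h + k ->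
  area (right_triangle h k) = ((h * k)%:E * area (right_triangle 1 1))%E.
Proof.
move=> h0 k0 hk0.
have [hk|hk] := eqVneq (h * k) 0.
  rewrite hk mul0e.
  have [a [b [ab cl]]] : exists a b, a != b /\
      right_triangle h k `<=` [set z | cross a b z = 0].
    have [h00|k00] : h = 0 \/ k = 0.
      by move/eqP: hk; rewrite mulf_eq0 => /orP[] /eqP; [left|right].
      exists (0, 0), (0, 1); split.
        by apply/eqP => -[/eqP]; rewrite eq_sym oner_eq0.
      move=> z [? ? hh] /=; rewrite /cross/= h00 in hk0 hh *.
      have : z.1 <= 0 by rewrite -(pmulr_rle0 _ (x := k)); lra.
      by lra.
    exists (0, 0), (1, 0); split.
      by apply/eqP => -[/eqP]; rewrite eq_sym oner_eq0.
    move=> z [? ? hh] /=; rewrite /cross/= k00 in hk0 hh *.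
    have : z.2 <= 0 by rewrite -(pmulr_rle0 _ (x := h)); lra.
    by lra.
  by apply: area_line ab cl; exact: measurable_right_triangle.
have h1 : 0 < h.
  by rewrite lt_neqAle h0 andbT; apply: contraNneq hk => <-; rewrite mul0r.
have k1 : 0 < k.
  by rewrite lt_neqAle k0 andbT; apply: contraNneq hk => <-; rewrite mulr0.
have D0 : h^-1 * k^-1 - 0 * 0 != 0.
  by rewrite mul0r subr0 mulf_neq0// invr_neq0// gt_eqF.
rewrite -(area_affine h^-1 0 0 0 k^-1 0 _ D0 (measurable_right_triangle 1 1)).
rewrite muleA -EFinM mul0r subr0 gtr0_norm ?mulr_gt0 ?invr_gt0//.
rewrite mulrACA !divff ?gt_eqF// mulr1 mul1e.
congr area; apply/seteqP; split=> z [z1 z2 z3]; split=> /=.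
- by rewrite !mul0r !addr0 mulr_ge0// invr_ge0.
- by rewrite !mul0r add0r !addr0 mulr_ge0// invr_ge0.
- rewrite -(ler_pM2l (x := h * k)) ?mulr_gt0//.
  suff -> : h * k * (1 * (h^-1 * z.1 + 0 * z.2 + 0)
   + 1 * (0 * z.1 + k^-1 * z.2 + 0)) = k * z.1 + h * z.2 by lra.
  by field; rewrite !gt_eqF.
- by move: z1 => /=; rewrite !mul0r !addr0 pmulr_rge0// invr_gt0.
- by move: z2 => /=; rewrite !mul0r add0r !addr0 pmulr_rge0// invr_gt0.
- move: z3 => /=; rewrite -(ler_pM2l (x := h * k)) ?mulr_gt0//.
  suff -> : h * k * (1 * (h^-1 * z.1 + 0 * z.2 + 0)
   + 1 * (0 * z.1 + k^-1 * z.2 + 0)) = k * z.1 + h * z.2 by lra.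
  by field; rewrite !gt_eqF.
Qed.

End RightTriangle.

(** * The two triangles cut off by consecutive halving diagonals *)

Definition det2 {R : realType} (u v : R * R) : R := u.1 * v.2 - u.2 * v.1.

Section Sector.
Local Open Scope classical_set_scope.
Context {R : realType}.
Implicit Types (a b p q : R * R) (P : set (R * R)).

(** The part of P between the side ap and the lines ab and pq is the triangle
    with vertices a, p and the intersection X of the two lines. In the
    coordinates (- cross a b z, cross p q z) it is a right triangle with its
    right angle at X. It lies in P because X is on the segment ab. In the
    degenerate case, where a or p is on the other line, both sides vanish. *)
Lemma area_sector P a p b q :
  measurable (P : set (plane R)) -> convex3 P -> P a -> P p -> P b -> a != p ->
  P `<=` left_side a p -> cross a b p <= 0 -> 0 <= cross p q a ->
  cross p q b <= 0 -> 0 < det2 (b - a) (q - p) ->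
  ((det2 (b - a) (q - p))%:E *
    area (P `&` right_side a b `&` left_side p q) =
   (- cross a b p * cross p q a)%:E * area (right_triangle 1 1))%E.
Proof.
move=> mP cP Pa Pp Pb ap Pl x1 y1 y2 D0.
set h := - cross a b p; set k := cross p q a.
have h0 : 0 <= h by rewrite oppr_ge0.
have k0 : 0 <= k by [].
have Dk : det2 (b - a) (q - p) = k - cross p q b.
  by rewrite /det2 /k /cross /=; ring.
pose T : set (plane R) := P `&` right_side a b `&` left_side p q.
pose G := affine_map (b.2 - a.2) (a.1 - b.1) (a.2 * b.1 - a.1 * b.2)
  (p.2 - q.2) (q.1 - p.1) (p.1 * q.2 - p.2 * q.1).
have G1 z : (G z).1 = - cross a b z by rewrite /G /affine_map /cross /=; ring.
have G2 z : (G z).2 = cross p q z by rewrite /G /affine_map /cross /=; ring.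
have mT : measurable T.
  by apply: measurableI; rewrite ?right_sideE; first apply: measurableI => //;
   exact: measurable_left_side.
(* The third side of the right triangle is the line ap. *)
have hypotenuse z : k * - cross a b z + h * cross p q z
    + det2 (b - a) (q - p) * cross a p z = h * k.
  by rewrite /k /h /det2 /cross /=; ring.
have TG : T `<=` G @^-1` right_triangle h k.
  move=> z [[Pz]]; rewrite /right_side /left_side /= => xz yz; split.
  - by rewrite G1 oppr_ge0.
  - by rewrite G2.
  - rewrite G1 G2 -(hypotenuse z) lerDl; apply: mulr_ge0; first exact: ltW.
    exact: Pl.
have DG : (b.2 - a.2) * (q.1 - p.1) - (a.1 - b.1) * (p.2 - q.2)
    = - det2 (b - a) (q - p) by rewrite /det2 /=; ring.
have DG0 : (b.2 - a.2) * (q.1 - p.1) - (a.1 - b.1) * (p.2 - q.2) != 0.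
  by rewrite DG oppr_eq0 gt_eqF.
have mG : measurable (G @^-1` right_triangle h k : set (plane R)).
  by apply: measurable_affine_preimage; exact: measurable_right_triangle.
have hk0 : 0 < h + k.
  rewrite lt_neqAle addr_ge0// andbT eq_sym paddr_eq0//.
  apply: contra ap => /andP[/eqP h00 /eqP k00].
  (* If h = k = 0, then a and p both are the intersection of the two lines. *)
  have e1 : det2 (b - a) (q - p) * (a.1 - p.1) = 0.
    transitivity (h * (q.1 - p.1) - k * (b.1 - a.1)).
      by rewrite /h /k /det2 /cross /=; ring.
    by rewrite h00 k00; ring.
  have e2 : det2 (b - a) (q - p) * (a.2 - p.2) = 0.
    transitivity (h * (q.2 - p.2) - k * (b.2 - a.2)).
      by rewrite /h /k /det2 /cross /=; ring.
    by rewrite h00 k00; ring.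
  move/eqP: e1; move/eqP: e2.
  rewrite !mulf_eq0 gt_eqF//= !subr_eq0 => /eqP e2 /eqP e1.
  by apply/eqP; rewrite [a]surjective_pairing [p]surjective_pairing e1 e2.
have GA : ((det2 (b - a) (q - p))%:E * area (G @^-1` right_triangle h k) =
    (h * k)%:E * area (right_triangle 1 1))%E.
  rewrite -area_right_triangle// -(gtr0_norm D0) -normrN -DG.
  exact: area_affine (measurable_right_triangle h k).
rewrite -GA; have [hk|hk] := eqVneq (h * k) 0.
  have G0 : area (G @^-1` right_triangle h k) = 0%E.
    by apply/eqP; move/eqP: GA; rewrite hk mul0e mule_eq0 eqe gt_eqF.
  rewrite G0; congr (_ * _)%E; apply/eqP; rewrite eq_le area_ge0 andbT -G0.
  exact: area_le.
congr (_ * area _)%E; apply/seteqP; split; first exact: TG.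
move=> z [zx zy zxy]; rewrite G1 in zx zxy; rewrite G2 in zy zxy.
split; last exact: zy.
split; last by rewrite /right_side /= -oppr_ge0.
have h1 : 0 < h.
  by rewrite lt_neqAle h0 andbT; apply: contraNneq hk => <-; rewrite mul0r.
have k1 : 0 < k.
  by rewrite lt_neqAle k0 andbT; apply: contraNneq hk => <-; rewrite mulr0.
(* z = s p + t a + u X, where X = (k b - (cross p q b) a) / D. *)
pose s := - cross a b z / h; pose t := cross p q z / k; pose u := 1 - s - t.
have s0 : 0 <= s by rewrite divr_ge0.
have t0 : 0 <= t by rewrite divr_ge0.
have u0 : 0 <= u.
  rewrite -(pmulr_rge0 _ (x := h * k)) ?mulr_gt0//.
  suff -> : h * k * u = h * k - (k * - cross a b z + h * cross p q z) by lra.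
  by rewrite /u /s /t; field; rewrite !gt_eqF.
set D := det2 (b - a) (q - p) in D0 Dk hypotenuse *.
have Dn : D != 0 by rewrite gt_eqF.
have hn : h != 0 by rewrite gt_eqF.
have kn : k != 0 by rewrite gt_eqF.
pose ta := t + u * (- cross p q b / D); pose ub := u * (k / D).
suff [e1 e2] : s * p.1 + ta * a.1 + ub * b.1 = z.1 /\
    s * p.2 + ta * a.2 + ub * b.2 = z.2.
  rewrite [z]surjective_pairing -e1 -e2; apply: cP => //.
  - by rewrite addr_ge0// mulr_ge0// divr_ge0 ?oppr_ge0// ltW.
  - by rewrite mulr_ge0// divr_ge0// ltW.
  - rewrite /ta /ub (_ : - cross p q b = D - k) ?Dk; last by ring.
    by rewrite -Dk /u; field.
have HD : D * h * k != 0 by rewrite !mulf_neq0.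
pose w := h * k - k * - cross a b z - h * cross p q z.
pose va := D * h * cross p q z + w * - cross p q b.
split; apply: (mulfI HD); rewrite /ta /ub /u /s /t.
  transitivity (D * k * - cross a b z * p.1 + va * a.1 + w * k * b.1).
    by rewrite /va /w; field; rewrite Dn hn kn.
  by rewrite /va /w /D /h /k /det2 /cross /=; ring.
transitivity (D * k * - cross a b z * p.2 + va * a.2 + w * k * b.2).
  by rewrite /va /w; field; rewrite Dn hn kn.
by rewrite /va /w /D /h /k /det2 /cross /=; ring.
Qed.

(** With x = cross a b and y = cross p q, equality of the areas of the two cut
    off triangles reads x(p) y(a) = x(q) y(b), where
    x(q) - x(p) = y(a) - y(b) = D is the determinant of the directions of ab
    and pq. This gives D x(p) = D y(b), and x(p) = y(b) says that a and q are
    equally far from the line pb. If D = 0, all four quantities vanish. *)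
Lemma halving_diagonals_parallel P a p b q :
  measurable (P : set (plane R)) -> (area P < +oo)%E -> convex3 P ->
  P a -> P p -> P b -> P q -> a != p -> b != q -> a != b -> p != q ->
  P `<=` left_side a p -> P `<=` left_side b q ->
  area (P `&` left_side a b) = area (P `&` right_side a b) ->
  area (P `&` left_side p q) = area (P `&` right_side p q) ->
  det2 (b - p) (q - a) = 0.
Proof.
move=> mP fP cP Pa Pp Pb Pq ap bq ab pq Pl1 Pl2 H1 H2.
have x1 : cross a b p <= 0.
  by have := Pl1 _ Pb; rewrite /left_side /cross/= => ?; lra.
have x2 : 0 <= cross a b q.
  by have := Pl2 _ Pa; rewrite /left_side /cross/= => ?; lra.
have y1 : 0 <= cross p q a.
  by have := Pl1 _ Pq; rewrite /left_side /cross/= => ?; lra.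
have y2 : cross p q b <= 0.
  by have := Pl2 _ Pp; rewrite /left_side /cross/= => ?; lra.
have Dx : det2 (b - a) (q - p) = cross a b q - cross a b p.
  by rewrite /det2 /cross /=; ring.
have Dy : det2 (b - a) (q - p) = cross p q a - cross p q b.
  by rewrite /det2 /cross /=; ring.
have Q : det2 (b - p) (q - a) = cross a b p - cross p q b.
  by rewrite /det2 /cross /=; ring.
have [D0|D0] := leP (det2 (b - a) (q - p)) 0; first by rewrite Q; lra.
have T1 := area_sector P a p b q mP cP Pa Pp Pb ap Pl1 x1 y1 y2 D0.
(* The other triangle is the same configuration with a, b and p, q exchanged. *)
have x2' : cross b a q <= 0 by rewrite crossNC oppr_le0.
have y2' : 0 <= cross q p b by rewrite crossNC oppr_ge0.
have y1' : cross q p a <= 0 by rewrite crossNC oppr_le0.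
have DD : det2 (a - b) (p - q) = det2 (b - a) (q - p).
  by rewrite /det2 /=; ring.
have T2 := area_sector P b q a p mP cP Pb Pq Pa bq Pl2 x2' y2' y1'.
rewrite DD in T2; have {}T2 := T2 D0.
have mL c d : measurable (left_side c d : set (plane R)).
  exact: measurable_left_side.
have mR c d : measurable (right_side c d : set (plane R)).
  by rewrite right_sideE.
have fin (X : set (plane R)) : measurable X -> X `<=` P -> area X \is a fin_num.
  move=> mX XP; rewrite ge0_fin_numE ?area_ge0//.
  by apply: le_lt_trans fP; exact: area_le.
(* Two halves of P share the piece on the right of both diagonals; removing it
   leaves the two triangles. *)
have eq12 : area (P `&` right_side a b `&` left_side p q)
          = area (P `&` right_side b a `&` left_side q p).
  have S1 := area_split a b P mP ab.
  have S2 := area_split p q P mP pq.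
  have mPR c d : measurable (P `&` right_side c d : set (plane R)).
    exact: measurableI.
  have S3 := area_split p q _ (mPR a b) pq.
  have S4 := area_split a b _ (mPR p q) ab.
  rewrite H1 in S1; rewrite H2 in S2.
  have E1 : P `&` right_side b a `&` left_side q p =
      P `&` right_side p q `&` left_side a b.
    rewrite right_sideE -(right_sideE p q) -!setIA.
    by rewrite [left_side a b `&` _]setIC.
  have E2 : P `&` right_side p q `&` right_side a b =
      P `&` right_side a b `&` right_side p q.
    by rewrite -!setIA [right_side p q `&` _]setIC.
  rewrite E1; rewrite E2 in S4.
  have f0 := fin P mP (fun _ h => h).
  have f1 : area (P `&` right_side a b) \is a fin_num by apply: fin => // z [].
  have f2 : area (P `&` right_side p q) \is a fin_num by apply: fin => // z [].
  have f3 : area (P `&` right_side a b `&` left_side p q) \is a fin_num.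
    by apply: fin => [|z [[]]//]; exact: measurableI.
  have f4 : area (P `&` right_side p q `&` left_side a b) \is a fin_num.
    by apply: fin => [|z [[]]//]; exact: measurableI.
  have f5 : area (P `&` right_side a b `&` right_side p q) \is a fin_num.
    by apply: fin => [|z [[]]//]; exact: measurableI.
  move: S1 S2 S3 S4.
  rewrite -(fineK f0) -(fineK f1) -(fineK f2).
  rewrite -(fineK f3) -(fineK f4) -(fineK f5).
  rewrite -!EFinD => -[S1] [S2] [S3] [S4]; congr EFin; lra.
have fc : area (right_triangle (1 : R) 1) \is a fin_num.
  by rewrite ge0_fin_numE ?area_ge0// area_right_triangle1_lty.
have c0 := @area_right_triangle1_gt0 R.
rewrite -eq12 T1 in T2; move: T2 c0; rewrite -(fineK fc) -!EFinM lte_fin.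
move=> -[/eqP T2] c0.
have {T2} : - cross a b p * cross p q a = - cross b a q * cross q p b.
  by apply/eqP; rewrite -(inj_eq (mulIf (lt0r_neq0 c0))).
rewrite (crossNC a b) (crossNC p q).
have -> : cross p q a = det2 (b - a) (q - p) + cross p q b by rewrite Dy; ring.
have -> : cross a b q = det2 (b - a) (q - p) + cross a b p by rewrite Dx; ring.
move=> e; rewrite Q.
have : det2 (b - a) (q - p) * (cross a b p - cross p q b) = 0 by lra.
by move=> /eqP; rewrite mulf_eq0 gt_eqF//= => /eqP.
Qed.

End Sector.

(** * Signed distances in a trapezoid, and separation *)

Section Quad.
Local Open Scope classical_set_scope.
Context {R : realType}.
Implicit Types (a b p q : R * R).

Lemma dist2_gt0 p q : p != q -> 0 < dist2 p q.
Proof.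
move=> pq; rewrite sqrtr_gt0 lt_neqAle addr_ge0 ?sqr_ge0// andbT eq_sym.
rewrite paddr_eq0 ?sqr_ge0//; apply: contra pq.
rewrite !sqrf_eq0 !subr_eq0 => /andP[/eqP e1 /eqP e2].
by rewrite [q]surjective_pairing [p]surjective_pairing e1 e2.
Qed.

(** Parallel vectors satisfy b - p = k (q - a), so the signed distances of p and
    q to ab have ratio - k; the ratio of the lengths is the absolute value of k,
    and k is nonnegative if p and q are on opposite sides of ab. If both are on
    ab, both sides vanish. *)
Lemma cross_trapezoid a b p q : q != a -> det2 (b - p) (q - a) = 0 ->
  cross a b p * cross a b q <= 0 ->
  cross a b p = - (dist2 p b / dist2 a q) * cross a b q.
Proof.
move=> qa Q x12.
pose N := (q.1 - a.1) ^+ 2 + (q.2 - a.2) ^+ 2.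
have d0 : 0 < dist2 a q by apply: dist2_gt0; rewrite eq_sym.
have Nn : N != 0 by rewrite gt_eqF// -sqrtr_gt0.
pose k := ((b.1 - p.1) * (q.1 - a.1) + (b.2 - p.2) * (q.2 - a.2)) / N.
have k1 : b.1 - p.1 = k * (q.1 - a.1).
  apply: (mulIf Nn); rewrite mulrAC /k divfK//.
  rewrite -[RHS]addr0 -(mulr0 (q.2 - a.2)) -Q /det2 /N /=.
  by ring.
have k2 : b.2 - p.2 = k * (q.2 - a.2).
  apply: (mulIf Nn); rewrite mulrAC /k divfK//.
  rewrite -[RHS]subr0 -(mulr0 (q.1 - a.1)) -Q /det2 /N /=.
  by ring.
have dk : dist2 p b / dist2 a q = `|k|.
  rewrite [dist2 p b](_ : _ = `|k| * dist2 a q) ?mulfK ?gt_eqF//.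
  by rewrite /dist2 k1 k2 !(exprMn _ k) -mulrDr sqrtrM ?sqr_ge0// sqrtr_sqr.
have x1k : cross a b p = - k * cross a b q.
  transitivity ((b.1 - a.1) * (p.2 - b.2) - (b.2 - a.2) * (p.1 - b.1)).
    by rewrite /cross; ring.
  by rewrite -(opprB b.2) -(opprB b.1 p.1) k1 k2 /cross; ring.
rewrite dk.
have [k0|k0] := leP 0 k; first by rewrite ger0_norm.
have : cross a b q ^+ 2 <= 0.
  rewrite -(pmulr_rle0 _ (x := - k)) ?oppr_gt0//.
  by move: x12; rewrite x1k -mulrA -expr2.
have := sqr_ge0 (cross a b q) => e1 e2.
have /eqP : cross a b q ^+ 2 = 0 by lra.
by rewrite sqrf_eq0 x1k => /eqP ->; rewrite !mulr0.
Qed.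

Lemma segment_left_side a b p q : left_side a b p -> left_side a b q ->
  segment p q `<=` left_side a b.
Proof.
rewrite /left_side /= => hp hq _ [t [t0 t1 ->]] /=.
rewrite [X in 0 <= X](_ : _ = (1 - t) * cross a b p + t * cross a b q).
  by rewrite addr_ge0// mulr_ge0// subr_ge0.
by rewrite /cross /= /GRing.scale /=; ring.
Qed.

Lemma line_separates_segments a b (x y z : R * R) :
  cross a b y = 0 -> cross a b x * cross a b z <= 0 ->
  line_separates a b (segment x y) (segment y z).
Proof.
move=> y0 xz.
rewrite /line_separates right_sideE.
have [x0|x0] := leP 0 (cross a b x).
  have [z0|z0] := leP (cross a b z) 0.
    by left; split; apply: segment_left_side;
      rewrite /left_side /= ?(crossNC a b) ?y0 ?oppr0 ?oppr_ge0.
  have x00 : cross a b x = 0.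
    by apply/eqP; rewrite eq_le x0 andbT -(pmulr_lle0 _ z0).
  by right; split; apply: segment_left_side;
    rewrite /left_side /= ?(crossNC a b) ?y0 ?x00 ?oppr0 ?oppr_ge0 // ltW.
right; split; apply: segment_left_side;
    rewrite /left_side /= ?(crossNC a b) ?y0 ?oppr0 ?oppr_ge0 //;
  first exact: ltW.
by rewrite -(nmulr_rle0 _ x0).
Qed.

End Quad.

(** * Indices modulo 2n *)

Lemma ZpD_neq (m k : nat) (i : 'Z_m) : (1 < m)%N -> (0 < k < m)%N ->
  i + k%:R != i.
Proof.
move=> m1 /andP[k0 k1]; apply/eqP => /(congr1 (fun j => j - i)).
rewrite addrAC subrr add0r => /(congr1 val)/=.
by rewrite val_Zp_nat// modn_small// => kk; rewrite kk in k0.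
Qed.

(** Parity is well defined modulo the even number 2n. *)
Lemma odd_Zp_succ (n : nat) (i : 'Z_(2 * n)) : (0 < n)%N ->
  odd ((i + 1)%R : 'Z_(2 * n)) = ~~ odd i.
Proof.
move=> n0; have n1 : (1 < 2 * n)%N by rewrite mul2n -addnn -addn1 leq_add.
have e : odd (Zp_trunc (2 * n)).+2 = false by rewrite Zp_cast// oddM.
pose d := (Zp_trunc (2 * n)).+2.
rewrite -[LHS]/(odd ((i + 1 %% d) %% d)%N).
by rewrite odd_mod// oddD odd_mod// addbT.
Qed.

(** * Half-area polygons *)

Section Polygon.
Context {R : realType} (n : nat) (g : 'Z_(2 * n) -> R * R).
Context (hn : (1 < n)%N) (hg : half_area_polygon g).
Implicit Types i : 'Z_(2 * n).

Let n2 : (1 < 2 * n)%N.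
Proof. by rewrite mul2n -addnn ltn_addr. Qed.

Lemma vertex_neq (k : nat) i : (0 < k < 2 * n)%N -> g i != g (i + k%:R).
Proof.
move=> kn; have [[ginj _ _] _] := hg.
by rewrite (inj_eq ginj) eq_sym; exact: ZpD_neq.
Qed.

Lemma central_diagonals_parallel i :
  det2 (g (i + n%:R) - g (i + 1)) (g (i + n%:R + 1) - g i) = 0.
Proof.
have [[ginj _ ori] half] := hg.
have mP := measurable_compact_plane _ (polygon_region_compact _ g).
have fP := compact_area_lty _ (polygon_region_compact _ g).
have cP := polygon_region_convex3 _ g.
have V := polygon_region_vertex _ g.
have n1 : (0 < n < 2 * n)%N by rewrite ltn_Pmull ?(ltnW hn).
have ap : g i != g (i + 1) by apply: (vertex_neq 1); rewrite n2.
have bq : g (i + n%:R) != g (i + n%:R + 1).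
  by apply: (vertex_neq 1); rewrite n2.
have ab : g i != g (i + n%:R) by exact: vertex_neq.
have pq : g (i + 1) != g (i + n%:R + 1) by rewrite addrAC; exact: vertex_neq.
have H1 := half i; have := half (i + 1); rewrite [i + 1 + _]addrAC => H2.
case: ori => [L|L].
  apply: (halving_diagonals_parallel (polygon_region g)) => //;
    by apply: polygon_region_left => j; exact: L.
(* A clockwise polygon has its region on the left of the reversed sides pa and
   qb, so the roles of the two diagonals are exchanged. *)
have := halving_diagonals_parallel (polygon_region g) (g (i + 1)) (g i)
  (g (i + n%:R + 1)) (g (i + n%:R)) mP fP cP (V _) (V _) (V _) (V _).
rewrite [g (i + 1) == _]eq_sym [g (i + n%:R + 1) == _]eq_sym => H.
have := H ap bq pq ab _ _ H2 H1.
have D : det2 (g (i + n%:R + 1) - g i) (g (i + n%:R) - g (i + 1)) =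
    - det2 (g (i + n%:R) - g (i + 1)) (g (i + n%:R + 1) - g i).
  by rewrite /det2; ring.
rewrite D => K; apply/eqP; rewrite -oppr_eq0; apply/eqP; apply: K;
by apply: polygon_region_left => j; rewrite -right_sideE; exact: L.
Qed.

(** In absolute value, the distance of the vertex i + n + 1 from the diagonal
    through the vertices i and i + n, times the length of that diagonal. *)
Definition diag_cross i := cross (g i) (g (i + n%:R)) (g (i + n%:R + 1)).

Lemma cross_next i :
  cross (g i) (g (i + n%:R)) (g (i + 1)) = - lambda g i * diag_cross i.
Proof.
apply: cross_trapezoid.
- rewrite -addrA natr1 eq_sym; apply: vertex_neq.
  by rewrite /= mul2n -addnn -addn1 ltn_add2l.
- exact: central_diagonals_parallel.
- have [[_ _ [L|L]] _] := hg; have := L i (i + n%:R); have := L (i + n%:R) i;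
  rewrite /left_side /right_side /= => h1 h2.
    by apply: mulr_le0_ge0; [move: h2|move: h1]; rewrite /cross => ?; lra.
  by apply: mulr_ge0_le0; [move: h2|move: h1]; rewrite /cross => ?; lra.
Qed.

Lemma diag_cross_sign :
  (forall i, 0 <= diag_cross i) \/ (forall i, diag_cross i <= 0).
Proof.
have [[_ _ [L|L]] _] := hg; [left|right] => i;
have := L (i + n%:R) i;
by rewrite /left_side /right_side /diag_cross /cross /= => ?; lra.
Qed.

Lemma cross_midpoint_next i :
  cross (g i) (g (i + n%:R)) (midpoint_envelope g (i + 1))
  = 2^-1 * (1 - lambda g i) * diag_cross i.
Proof.
transitivity (2^-1 * (cross (g i) (g (i + n%:R)) (g (i + 1)) + diag_cross i)).
  rewrite /midpoint_envelope /diag_cross [i + 1 + _]addrAC /cross /=.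
  by rewrite /GRing.scale /=; field.
by rewrite cross_next; ring.
Qed.

(** The triangles that M(i) spans with the diagonal of index i + 1 and M(i + 1)
    with the diagonal of index i have equal signed areas: their difference is a
    multiple of the determinant that vanishes by
    [central_diagonals_parallel]. *)
Lemma cross_midpoint_prev i :
  cross (g (i + 1)) (g (i + 1 + n%:R)) (midpoint_envelope g i)
  = 2^-1 * (1 - lambda g i) * diag_cross i.
Proof.
rewrite -cross_midpoint_next /midpoint_envelope [i + 1 + _]addrAC.
have := central_diagonals_parallel i.
by rewrite /det2 /cross /= /GRing.scale /= => Q; lra.
Qed.

Lemma cross_midpoint_self i :
  cross (g i) (g (i + n%:R)) (midpoint_envelope g i) = 0.
Proof. by rewrite /midpoint_envelope /cross /= /GRing.scale/=; field. Qed.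

Lemma lambda_gt0 i : 0 < lambda g i.
Proof.
apply: divr_gt0; apply: dist2_gt0.
  have -> : i + n%:R = i + 1 + n.-1%:R.
    by rewrite -addrA nat1r prednK// ltnW.
  apply: vertex_neq; rewrite -ltnS prednK ?(ltnW hn)// hn/=.
  exact: leq_pmull.
rewrite -addrA natr1; apply: vertex_neq.
by rewrite /= mul2n -addnn -addn1 ltn_add2l.
Qed.

(** If the two ratios are mutually inverse, then 1 - lambda(i) and
    1 - lambda(i - 1) have opposite signs. *)
Lemma mul_lambda_eq1_cusp i : lambda g i * lambda g (i - 1) = 1 -> is_cusp g i.
Proof.
move=> l1.
have := cross_midpoint_prev (i - 1); have := cross_midpoint_next i.
rewrite subrK => c2 c1; have c0 := cross_midpoint_self i.
have l0 := lambda_gt0 i; have l0' := lambda_gt0 (i - 1).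
apply: line_separates_segments => //.
rewrite c1 c2.
set l := lambda g i in l1 l0 *; set l' := lambda g (i - 1) in l1 l0' *.
have l_ : (1 - l') * (1 - l) <= 0.
  rewrite -(pmulr_rle0 _ l0).
  have -> : l * ((1 - l') * (1 - l)) = (l - l * l') * (1 - l) by ring.
  by rewrite l1 -(opprB 1 l) mulNr -expr2 oppr_le0 sqr_ge0.
have S : 0 <= diag_cross (i - 1) * diag_cross i.
  by have [D|D] := diag_cross_sign; [apply: mulr_ge0|apply: mulr_le0].
by have := mulr_le0_ge0 l_ S; lra.
Qed.

Lemma odd_symmetric_cusp i : odd_symmetric g -> is_cusp g i.
Proof.
move=> [c hc]; apply: mul_lambda_eq1_cusp.
have l0 := lambda_gt0 i; move: l0; rewrite !hc.
have -> : odd i = ~~ odd ((i - 1)%R : 'Z_(2 * n)).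
  by rewrite -odd_Zp_succ ?subrK// ltnW.
case: odd => /= c0; last by rewrite divff// gt_eqF.
by rewrite mulVf// gt_eqF// -invr_gt0.
Qed.

End Polygon.

Theorem corollary4p5 (R : realType) (n : nat) (hn : (1 < n)%N)
  (g : 'Z_(2 * n) -> R * R)
  (hg : half_area_polygon g) (hodd : odd_symmetric g) :
  #|[set i : 'I_n | `[< is_cusp g (i.+1)%:R >]]%SET| = n.
Proof.
rewrite -[RHS]card_ord -cardsT; congr #|pred_of_set _|.
apply/setP => i; rewrite !inE; apply/asboolP.
exact: odd_symmetric_cusp.
Qed.
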